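(* Let $\mathsf{E}$ be a logic. If $\mathsf{E}$ is distributive, then the universal logic $\mathsf{U}_\kappa(\mathsf{E})$ is distributive for all $\kappa$ (that is, for $\kappa=[N]$ with any $N\in\mathbb{N}$ and for $\kappa=\mathbb{N}$). Reciprocally, if $\mathsf{U}_\kappa(\mathsf{E})$ is distributive for some such $\kappa$, then $\mathsf{E}$ is distributive.
   Context: A logic is a complete orthocomplemented (not necessarily distributive) lattice $(\mathsf{E},\subseteq,\cup,\cap,{}^c,\mathbf{0},\mathbf{1})$. Here $[N]=\{1,\dots,N\}$, $N\geq1$. $\mathsf{E}^\kappa$ denotes the set of families $A=(a_n)_{n\in\kappa}$ with $a_n\in\mathsf{E}$, where all families having at least one component equal to $\mathbf{0}$ are identified with each other, i.e. with $\hat{\mathbf{0}}=(\mathbf{0},\mathbf{0},\dots)$; and $\hat{\mathbf{1}}=(\mathbf{1},\mathbf{1},\dots)$. The order is component-wise: $A\subseteq B$ iff $a_n\subseteq b_n$ for all $n$ (using the constant family to represent $\hat{\mathbf{0}}$); infima $\cap$ are computed component-wise (followed by the identification). A term is a function $i\in I\mapsto A^i\in\mathsf{E}^\kappa$, written $\bigsqcup_{i\in I}A^i$, with $|I|\leq2^{|\mathsf{E}^\kappa|}$; $\mathsf{T}(\mathsf{E}^\kappa)$ is the collection of terms. Put $\bigsqcup_{i\in I}A^i\backsim\bigsqcup_{j\in J}B^j$ iff for every $i\in I$ there is $j\in J$ with $A^i\subseteq B^j$ (if $J=\emptyset$: $A^i=\hat{\mathbf{0}}$), and for every $j\in J$ there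 is $i\in I$ with $B^j\subseteq A^i$ (if $I=\emptyset$: $B^j=\hat{\mathbf{0}}$). This is an equivalence relation; $\mathsf{D}_\kappa(\mathsf{E}):=\mathsf{T}(\mathsf{E}^\kappa)/\backsim$. For families with larger index sets, $[\bigsqcup_{i\in I}A^i]$ denotes the class of the terms equivalent (same condition) to the family. Every class has a representative with $I\neq\emptyset$, and such representatives are always used. Order: $[\bigsqcup_{i\in I}A^i]\leq[\bigsqcup_{j\in J}B^j]$ iff $[\bigsqcup_{i\in I}A^i\sqcup\bigsqcup_{j\in J}B^j]=[\bigsqcup_{j\in J}B^j]$ (here $\sqcup$ is the family on the disjoint union of $I$ and $J$). With it $\mathsf{D}_\kappa(\mathsf{E})$ is a complete lattice with suprema $\bigvee$, infima $\bigwedge$, bottom $[\hat{\mathbf{0}}]$ and top $[\hat{\mathbf{1}}]$. One regards $\mathsf{E}^\kappa\subseteq\mathsf{D}_\kappa(\mathsf{E})$ via the injection $A\mapsto[A]$; then $[\bigsqcup_{i\in I}A^i]=\bigvee_{i\in I}A^i$, so every element of $\mathsf{D}_\kappa(\mathsf{E})$ is of the form $\bigvee_{i\in I}A^i$ with $I\neq\emptyset$, $A^i=(a^i_n)_{n\in\kappa}\in\mathsf{E}^\kappa$. The function $*:\mathsf{D}_\kappa(\mathsf{E})\to\mathsf{D}_\kappa(\mathsf{E})$ is the (well-defined) function $$\Big(\bigvee_{i\in I}A^i\Big)^*=\bigvee_{f:I\to\kappa}\Big(\bigcap_{i\in f^{-1}(n)}(a^i_n)^c\Big)_{n\in\kappa},$$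 where an empty meet in $\mathsf{E}$ is $\mathbf{1}$. $\mathbb{A}^{**}=(\mathbb{A}^* )^*$. The universal logic is $\mathsf{U}_\kappa(\mathsf{E})=\{\mathbb{A}\in\mathsf{D}_\kappa(\mathsf{E}):\mathbb{A}^{**}=\mathbb{A}\}$ with the inherited order; it is an orthocomplemented complete lattice with the same infima $\wedge$, bottom $\hat{\mathbf{0}}$ and top $\hat{\mathbf{1}}$ as $\mathsf{D}_\kappa(\mathsf{E})$, supremum $\coprod S=(\bigvee S)^{**}$ and orthocomplementation $*$. *)

(* Defs.v *)
(* For a logic E and an exponent k: [power E k] is E^k, [dterm E k] is        *)
(* D_k(E), [star] is the operation * on D_k(E), and [universal E k] is the    *)
(* universal logic U_k(E); [cls F] is the class [\bigsqcup_i F i] in D_k(E).  *)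
From HB Require Import structures.
From mathcomp Require Import all_boot all_order.
From mathcomp Require Import boolp classical_sets functions cardinality.

Set Implicit Arguments.
Unset Strict Implicit.
Unset Printing Implicit Defensive.

Import Order.Theory.
Local Open Scope card_scope.
Local Open Scope classical_set_scope.
Local Open Scope order_scope.

HB.mixin Record TBLattice_isComplete d T of Order.TBLattice d T := {
  bigmeet : set T -> T;
  bigjoin : set T -> T;
  bigmeet_lb : forall (S : set T) x, S x -> bigmeet S <= x;
  bigmeet_glb : forall (S : set T) x,
    (forall y, S y -> x <= y) -> x <= bigmeet S;
  bigjoin_ub : forall (S : set T) x, S x -> x <= bigjoin S;
  bigjoin_lub : forall (S : set T) x,
    (forall y, S y -> y <= x) -> bigjoin S <= x;
}.

#[short(type="completeLatticeType")]
HB.structure Definition CompleteLattice d :=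
  { T of TBLattice_isComplete d T & Order.TBLattice d T }.

HB.factory Record POrder_isCompleteLattice d T of Order.POrder d T := {
  bigmeet : set T -> T;
  bigjoin : set T -> T;
  bigmeet_lb : forall (S : set T) x, S x -> bigmeet S <= x;
  bigmeet_glb : forall (S : set T) x,
    (forall y, S y -> x <= y) -> x <= bigmeet S;
  bigjoin_ub : forall (S : set T) x, S x -> x <= bigjoin S;
  bigjoin_lub : forall (S : set T) x,
    (forall y, S y -> y <= x) -> bigjoin S <= x;
}.

HB.builders Context d T of POrder_isCompleteLattice d T.

Let meet x y := bigmeet [set x; y].
Let join x y := bigjoin [set x; y].

Let meetP x y z : (x <= meet y z) = (x <= y) && (x <= z).
Proof.
apply/idP/andP => [h|[xy xz]].
  by split; apply: (le_trans h); apply: bigmeet_lb; [left|right].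
by apply: bigmeet_glb => t [->|->].
Qed.

Let joinP x y z : (join x y <= z) = (x <= z) && (y <= z).
Proof.
apply/idP/andP => [h|[xz yz]].
  by split; apply: le_trans h; apply: bigjoin_ub; [left|right].
by apply: bigjoin_lub => t [->|->].
Qed.

HB.instance Definition _ := Order.POrder_MeetJoin_isLattice.Build d T meetP joinP.

Let bottom_le x : bigjoin set0 <= x.
Proof. by apply: bigjoin_lub. Qed.

Let top_ge x : x <= bigmeet set0.
Proof. by apply: bigmeet_glb. Qed.

HB.instance Definition _ := Order.hasBottom.Build d T bottom_le.
HB.instance Definition _ := Order.hasTop.Build d T top_ge.
HB.instance Definition _ := TBLattice_isComplete.Build d T
  bigmeet_lb bigmeet_glb bigjoin_ub bigjoin_lub.
HB.end.

HB.mixin Record CompleteLattice_isOrtho d T of CompleteLattice d T := {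
  ocompl : T -> T;
  ocomplK : involutive ocompl;
  le_ocompl : forall x y : T, x <= y -> ocompl y <= ocompl x;
  meetx_ocompl : forall x : T, x `&` ocompl x = \bot;
  joinx_ocompl : forall x : T, x `|` ocompl x = \top;
}.

#[short(type="logicType")]
HB.structure Definition Logic d :=
  { T of CompleteLattice_isOrtho d T & CompleteLattice d T }.

Definition distributive_lattice d (L : latticeType d) : Prop :=
  left_distributive (@Order.meet d L) (@Order.join d L).

(* The admissible index sets [N] = {1, ..., N} (N >= 1) and the set of all    *)
(* natural numbers.  Only the cardinality of [N] matters: it is rendered by   *)
(* the ordinal type 'I_N.                                                     *)
Variant exponent := Upto N of (0 < N)%N | AllNat.

Definition exponent_sort (k : exponent) : Type :=
  match k with @Upto N _ => 'I_N | AllNat => nat end.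
Coercion exponent_sort : exponent >-> Sortclass.

Lemma exponent_inhabited (k : exponent) : inhabited k.
Proof. by case: k => [N N0|]; constructor; [exact: (Ordinal N0)|exact: 0%N]. Qed.

Section PowerFamilies.
Variables (d : Order.disp_t) (E : logicType d) (k : exponent).

Definition vanishes (a : k -> E) : Prop := exists n, a n = \bot.

Definition same_family (a b : k -> E) : bool :=
  `[< a = b \/ vanishes a /\ vanishes b >].

Lemma same_family_refl : reflexive same_family.
Proof. by move=> a; apply/asboolP; left. Qed.

Lemma same_family_sym : symmetric same_family.
Proof.
move=> a b; apply/asboolP/asboolP; (case=> [->|[? ?]]; first by left);
  by right; split.
Qed.

Lemma same_family_trans : transitive same_family.
Proof.
move=> b a c /asboolP[->//|[va vb]] /asboolP[<-|[_ vc]]; apply/asboolP;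
  by right; split.
Qed.

Canonical same_family_equiv :=
  EquivRel same_family same_family_refl same_family_sym same_family_trans.

Definition power := {eq_quot same_family}%qT.

HB.instance Definition _ := Choice.on power.

Definition pow (a : k -> E) : power := (\pi_power a)%qT.

Definition pow0 : power := pow (fun=> \bot).

(* The components of an element of [power]: the vanishing families are        *)
(* represented by the constant family \bot.                                   *)
Definition component (A : power) : k -> E :=
  if A == pow0 then fun=> \bot else repr A.

Definition le_power (A B : power) : Prop :=
  forall n, component A n <= component B n.

Lemma eq_pow a b : pow a = pow b <-> same_family a b.
Proof. by rewrite /pow; split => [/eqmodP|h] //; apply/eqmodP. Qed.

Lemma pow_eq0 a : pow a = pow0 <-> vanishes a.
Proof.
have v0 : vanishes (fun=> \bot : E).
  by case: (exponent_inhabited k) => n; exists n.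
rewrite /pow0 eq_pow; split => [/asboolP[->//|[]//]|va].
by apply/asboolP; right.
Qed.

Lemma component_pow0 a : vanishes a -> component (pow a) = fun=> \bot.
Proof. by move=> /pow_eq0 ->; rewrite /component eqxx. Qed.

Lemma component_pow a : ~ vanishes a -> component (pow a) = a.
Proof.
move=> nva; rewrite /component; case: eqP => [/pow_eq0//|_].
have : pow (repr (pow a)) = pow a by rewrite /pow reprK.
by move=> /eq_pow/asboolP[//|[_ /nva]].
Qed.

Lemma pow_component A : pow (component A) = A.
Proof. by rewrite /component; case: eqP => [->//|_]; rewrite /pow reprK. Qed.

Lemma component_vanish A : vanishes (component A) <-> A = pow0.
Proof. by rewrite -pow_eq0 pow_component. Qed.

Lemma le_power_refl A : le_power A A.
Proof. by move=> n. Qed.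

Lemma le_power_trans B A C : le_power A B -> le_power B C -> le_power A C.
Proof. by move=> h1 h2 n; apply: le_trans (h1 n) (h2 n). Qed.

Lemma le_power_anti A B : le_power A B -> le_power B A -> A = B.
Proof.
move=> h1 h2; rewrite -(pow_component A) -(pow_component B); congr pow.
by apply/funext => n; apply/le_anti/andP; split.
Qed.

Lemma le0power A : le_power pow0 A.
Proof. by move=> n; rewrite /component eqxx le0x. Qed.

Lemma le_power0 A : le_power A pow0 <-> A = pow0.
Proof.
split => [h|->]; last exact: le_power_refl.
exact: le_power_anti h (le0power A).
Qed.

End PowerFamilies.

Section Terms.
Variables (d : Order.disp_t) (E : logicType d) (k : exponent).
Notation Ek := (power E k).

(* Up to reindexing, the families (A^i)_(i in I) with |I| <= 2^|E^k| are      *)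
(* those whose index set is a subset of the power set of E^k, see             *)
(* [term_reindex]; fixing the ambient set makes the terms a set.              *)
Record term := Term { idx : set (set Ek); fam : idx -> Ek }.

HB.instance Definition _ := gen_eqMixin term.
HB.instance Definition _ := gen_choiceMixin term.

Lemma term_reindex (I : Type) (F : I -> Ek) :
  [set: I] #<= [set: set Ek] ->
  exists (t : term) (h : I -> idx t), bijective h /\ forall i, fam (h i) = F i.
Proof.
move=> /(@pcard_leTP I (set Ek))[f].
have finj : injective f by move=> x y; apply: inj; rewrite inE.
pose S : set (set Ek) := [set s | exists i, s = f i].
have inS i : f i \in S by apply/mem_set; exists i.
have pre (s : S) : exists i, val s = f i by apply: set_mem (valP s).
pose g (s : S) := projT1 (cid (pre s)).
have gE s : f (g s) = val s by rewrite /g; case: cid.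
exists (Term (F \o g)), (fun i => exist _ (f i) (inS i)); split; last first.
  by move=> i /=; congr F; apply: finj; rewrite gE.
exists g => [i|s]; first by apply: finj; rewrite gE.
by apply: val_inj; rewrite /= gE.
Qed.

Definition dominated (I J : Type) (F : I -> Ek) (G : J -> Ek) : Prop :=
  forall i, (exists j, le_power (F i) (G j)) \/
            (~ inhabited J /\ F i = pow0 E k).

Definition fam_equiv (I J : Type) (F : I -> Ek) (G : J -> Ek) : Prop :=
  dominated F G /\ dominated G F.

Definition term_equiv (s t : term) : bool :=
  `[< fam_equiv (@fam s) (@fam t) >].

(* The lower set generated by a family and 0.                                 *)
Definition below (I : Type) (F : I -> Ek) (A : Ek) : Prop :=
  A = pow0 E k \/ exists i, le_power A (F i).

Lemma dominatedP I J (F : I -> Ek) (G : J -> Ek) :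
  dominated F G <-> (forall A, below F A -> below G A).
Proof.
split => [FG A [->|[i Ai]]|h i]; first by left.
  have [[j Fj]|[_ Fi]] := FG i; last by left; apply/le_power0; rewrite -Fi.
  by right; exists j; apply: le_power_trans Ai Fj.
have [|Fi0|[j Fj]] := h (F i); first by right; exists i; apply: le_power_refl.
  have [[j]|nJ] := pselect (inhabited J); last by right.
  by left; exists j; rewrite Fi0; apply: le0power.
by left; exists j.
Qed.

Lemma fam_equivP I J (F : I -> Ek) (G : J -> Ek) :
  fam_equiv F G <-> (forall A, below F A <-> below G A).
Proof.
split => [[/dominatedP h1 /dominatedP h2] A|h]; first by split; [apply: h1|apply: h2].
by split; apply/dominatedP => A; apply h.
Qed.

Lemma term_equiv_refl : reflexive term_equiv.
Proof. by move=> s; apply/asboolP/fam_equivP. Qed.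

Lemma term_equiv_sym : symmetric term_equiv.
Proof. by move=> s t; apply/asboolP/asboolP => -[]. Qed.

Lemma term_equiv_trans : transitive term_equiv.
Proof.
move=> t s u /asboolP/fam_equivP h1 /asboolP/fam_equivP h2.
by apply/asboolP/fam_equivP => A; rewrite h1.
Qed.

Canonical term_equiv_equiv :=
  EquivRel term_equiv term_equiv_refl term_equiv_sym term_equiv_trans.

Definition dterm := {eq_quot term_equiv}%qT.

HB.instance Definition _ := Choice.on dterm.

Lemma fam_term (I : Type) (F : I -> Ek) :
  exists t : term, fam_equiv F (@fam t).
Proof.
pose S : set (set Ek) := [set s | exists i, s = [set F i]].
have pre (s : S) : exists A, val s = [set A] /\ exists i, A = F i.
  by have [i si] := set_mem (valP s); exists (F i); split=> //; exists i.
pose g (s : S) := projT1 (cid (pre s)).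
have gP s : val s = [set g s] /\ exists i, g s = F i by rewrite /g; case: cid.
exists (Term g); apply/fam_equivP => A; split=> [[->|[i AF]]|[->|[/= s As]]];
  try by left.
  have inS : [set F i] \in S by apply/mem_set; exists i.
  pose s : S := SigSub inS; right; exists s => /=.
  have [/= e _] := gP s.
  by have <- : F i = g s by have : [set F i] (F i) by []; rewrite e.
by have [_ [i gi]] := gP s; right; exists i; rewrite -gi.
Qed.

(* The class of the terms equivalent to a family with arbitrary index set.    *)
Definition cls (I : Type) (F : I -> Ek) : dterm :=
  (\pi_dterm (projT1 (cid (fam_term F))))%qT.

Definition repr_fam (X : dterm) : idx (repr X) -> Ek := @fam (repr X).
Arguments repr_fam : clear implicits.

Lemma eq_dterm (s t : term) :
  (\pi_dterm s)%qT = (\pi_dterm t)%qT <-> fam_equiv (@fam s) (@fam t).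
Proof. by split => [/eqmodP/asboolP|h] //; apply/eqmodP/asboolP. Qed.

Lemma eq_cls I J (F : I -> Ek) (G : J -> Ek) :
  cls F = cls G <-> fam_equiv F G.
Proof.
rewrite /cls eq_dterm; case: cid => s /= /fam_equivP Fs.
case: cid => t /= /fam_equivP Gt.
by split => /fam_equivP h; apply/fam_equivP => A;
  [rewrite Fs Gt|rewrite -Fs -Gt].
Qed.

Lemma cls_term (t : term) : cls (@fam t) = (\pi_dterm t)%qT.
Proof.
rewrite /cls eq_dterm; case: cid => s /= /fam_equivP ts.
by apply/fam_equivP => A; rewrite ts.
Qed.

Lemma cls_repr (X : dterm) : cls (repr_fam X) = X.
Proof. by rewrite cls_term reprK. Qed.

Definition mem_dterm (X : dterm) (A : Ek) : Prop := below (repr_fam X) A.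

Lemma mem_cls I (F : I -> Ek) A : mem_dterm (cls F) A <-> below F A.
Proof.
by have /eq_cls/fam_equivP := cls_repr (cls F); apply.
Qed.

Lemma dtermP (X Y : dterm) : (forall A, mem_dterm X A <-> mem_dterm Y A) <-> X = Y.
Proof.
by split => [h|->//]; rewrite -(cls_repr X) -(cls_repr Y); apply/eq_cls/fam_equivP.
Qed.

Definition sqcup (I J : Type) (F : I -> Ek) (G : J -> Ek) (u : I + J) : Ek :=
  match u with inl i => F i | inr j => G j end.

Definition le_dterm (X Y : dterm) : bool :=
  cls (sqcup (repr_fam X) (repr_fam Y)) == Y.

Lemma below_sqcup I J (F : I -> Ek) (G : J -> Ek) A :
  below (sqcup F G) A <-> below F A \/ below G A.
Proof.
split => [[->|[[i|j] h]]|[[->|[i h]]|[->|[j h]]]]; try by do ?left.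
- by left; right; exists i.
- by right; right; exists j.
- by right; exists (inl i).
- by right; exists (inr j).
Qed.

Lemma le_cls I J (F : I -> Ek) (G : J -> Ek) :
  le_dterm (cls F) (cls G) = (cls (sqcup F G) == cls G).
Proof.
rewrite /le_dterm; congr (_ == _); apply/dtermP => A.
by rewrite !mem_cls !below_sqcup; rewrite -!/(mem_dterm _ _) !mem_cls.
Qed.

Lemma le_dtermP (X Y : dterm) :
  reflect (forall A, mem_dterm X A -> mem_dterm Y A) (le_dterm X Y).
Proof.
apply: (iffP eqP) => [/dtermP h A XA|h].
  by apply/h/mem_cls/below_sqcup; left.
apply/dtermP => A; rewrite mem_cls below_sqcup -!/(mem_dterm _ _).
by split=> [[/h//|//]|]; right.
Qed.

Lemma le_dterm_refl : reflexive le_dterm.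
Proof. by move=> X; apply/le_dtermP. Qed.

Lemma le_dterm_anti : antisymmetric le_dterm.
Proof.
move=> X Y /andP[/le_dtermP h1 /le_dtermP h2].
by apply/dtermP => A; split; [apply: h1|apply: h2].
Qed.

Lemma le_dterm_trans : transitive le_dterm.
Proof.
by move=> Y X Z /le_dtermP h1 /le_dtermP h2; apply/le_dtermP => A /h1/h2.
Qed.

HB.instance Definition _ := Order.Le_isPOrder.Build (Order.Disp tt tt) dterm
  le_dterm_refl le_dterm_anti le_dterm_trans.

Lemma leD_P (X Y : dterm) :
  reflect (forall A, mem_dterm X A -> mem_dterm Y A) (X <= Y).
Proof. exact: le_dtermP. Qed.

Definition bigjoin_dterm (S : set dterm) : dterm :=
  cls (fun u : {X : S & idx (repr (val X))} => fam (projT2 u)).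

Definition bigmeet_dterm (S : set dterm) : dterm :=
  bigjoin_dterm [set X | forall Y, S Y -> X <= Y].

Lemma bigjoin_dterm_ub (S : set dterm) X : S X -> X <= bigjoin_dterm S.
Proof.
move=> SX; apply/leD_P => A [->|[i h]]; apply/mem_cls; first by left.
by right; exists (existT _ (exist _ X (mem_set SX)) i).
Qed.

Lemma bigjoin_dterm_lub (S : set dterm) X :
  (forall Y, S Y -> Y <= X) -> bigjoin_dterm S <= X.
Proof.
move=> h; apply/leD_P => A /mem_cls[->|[[[Y SY] i] /= hA]]; first by left.
by have /h/leD_P := set_mem SY; apply; right; exists i.
Qed.

Lemma bigmeet_dterm_lb (S : set dterm) X : S X -> bigmeet_dterm S <= X.
Proof. by move=> SX; apply: bigjoin_dterm_lub => Y; apply. Qed.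

Lemma bigmeet_dterm_glb (S : set dterm) X :
  (forall Y, S Y -> X <= Y) -> X <= bigmeet_dterm S.
Proof. by move=> h; apply: bigjoin_dterm_ub. Qed.

HB.instance Definition _ := POrder_isCompleteLattice.Build (Order.Disp tt tt) dterm
  bigmeet_dterm_lb bigmeet_dterm_glb bigjoin_dterm_ub bigjoin_dterm_lub.

Definition star_fam (I : Type) (F : I -> Ek) (f : I -> k) : Ek :=
  pow (fun n => bigmeet [set ocompl (component (F i) n) | i in [set i | f i = n]]).

Definition star (X : dterm) : dterm := cls (star_fam (repr_fam X)).

Definition orthogonal (A B : Ek) : Prop :=
  exists n, component A n <= ocompl (component B n).

Lemma orthogonal_sym A B : orthogonal A B -> orthogonal B A.
Proof.
by move=> [n h]; exists n; rewrite -(ocomplK (component B n)); apply: le_ocompl.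
Qed.

Lemma orthogonal_le A B C : le_power A B -> orthogonal B C -> orthogonal A C.
Proof. by move=> h [n]; exists n; apply: le_trans (h n) _. Qed.

Lemma orthogonal0 B : orthogonal (pow0 E k) B.
Proof.
by case: (exponent_inhabited k) => n; exists n; rewrite /component eqxx le0x.
Qed.

Lemma orthogonalxx A : orthogonal A A -> A = pow0 E k.
Proof.
move=> [n h]; apply/component_vanish; exists n; apply/eqP.
by rewrite -lex0 -(meetx_ocompl (component A n)) lexI lexx.
Qed.

Lemma below_star I (F : I -> Ek) A :
  below (star_fam F) A <-> (forall i, orthogonal A (F i)).
Proof.
split => [[-> i|[f Af] i]|h]; first exact: orthogonal0.
- pose a n := bigmeet [set ocompl (component (F i) n) | i in [set i | f i = n]].
  have [va|nva] := pselect (vanishes a).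
    have : star_fam F f = pow0 E k by apply/pow_eq0.
    by move: Af => /[swap] -> /le_power0 ->; apply: orthogonal0.
  exists (f i); apply: le_trans (Af (f i)) _.
  by rewrite component_pow//; apply: bigmeet_lb; exists i.
- have [->|A0] := pselect (A = pow0 E k); first by left.
  have [f hf] := choice h; right; exists f => n.
  have Ale m : component A m <=
      bigmeet [set ocompl (component (F i) m) | i in [set i | f i = m]].
    by apply: bigmeet_glb => _ [i /= <- <-]; apply: hf.
  rewrite component_pow; [exact: Ale|].
  move=> [m am]; apply/A0/component_vanish; exists m; apply/eqP.
  by rewrite -lex0 -[leRHS]am; exact: Ale.
Qed.

(* [star] does not depend on the family representing its argument, so it may  *)
(* be computed on any representative, in particular on one with I nonempty.   *)
Lemma star_cls I (F : I -> Ek) : star (cls F) = cls (star_fam F).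
Proof.
apply/eq_cls/fam_equivP => A; rewrite !below_star.
have /eq_cls[h1 h2] := cls_repr (cls F).
split => h i; [have [[j hj]|[_ ->]] := h2 i|have [[j hj]|[_ ->]] := h1 i];
  try by apply/orthogonal_sym/orthogonal0.
- by apply/orthogonal_sym/(orthogonal_le hj)/orthogonal_sym.
- by apply/orthogonal_sym/(orthogonal_le hj)/orthogonal_sym.
Qed.

Lemma mem_star X A :
  mem_dterm (star X) A <-> (forall B, mem_dterm X B -> orthogonal A B).
Proof.
rewrite mem_cls below_star; split=> [h B [->|[i Bi]]|h i].
- exact/orthogonal_sym/orthogonal0.
- exact/orthogonal_sym/(orthogonal_le Bi)/orthogonal_sym.
- by apply: h; right; exists i; apply: le_power_refl.
Qed.

Lemma le_star X Y : X <= Y -> star Y <= star X.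
Proof.
by move=> /leD_P XY; apply/leD_P => A /mem_star h; apply/mem_star => B /XY/h.
Qed.

Lemma le_starK X : X <= star (star X).
Proof.
apply/leD_P => A XA; apply/mem_star => B /mem_star h.
exact/orthogonal_sym/h.
Qed.

Lemma starKK X : star (star (star X)) = star X.
Proof. by apply/le_anti/andP; split; [exact/le_star/le_starK|exact: le_starK]. Qed.

Definition universal := {X : dterm | star (star X) == X}.

HB.instance Definition _ := [isSub of universal for @sval _ _].
HB.instance Definition _ := [Choice of universal by <:].
HB.instance Definition _ := [SubChoice_isSubPOrder of universal by <: with (Order.Disp tt tt)].

Lemma leU (x y : universal) : (x <= y) = (val x <= val y).
Proof. by rewrite leEsub. Qed.

Lemma starK_bigmeet (S : set universal) :
  star (star (bigmeet [set val x | x in S])) == bigmeet [set val x | x in S].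
Proof.
apply/eqP/le_anti/andP; split; last exact: le_starK.
apply: bigmeet_glb => _ [x Sx <-]; rewrite -[leRHS](eqP (valP x)).
by apply/le_star/le_star/bigmeet_lb; exists x.
Qed.

Lemma starK_star X : star (star (star X)) == star X.
Proof. by rewrite starKK. Qed.

Definition bigmeet_universal (S : set universal) : universal :=
  exist _ (bigmeet [set val x | x in S]) (starK_bigmeet S).

Definition bigjoin_universal (S : set universal) : universal :=
  exist _ (star (star (bigjoin [set val x | x in S]))) (starK_star _).

Definition star_universal (x : universal) : universal :=
  exist _ (star (val x)) (starK_star _).

Lemma bigmeet_universal_lb (S : set universal) x : S x -> bigmeet_universal S <= x.
Proof. by move=> Sx; rewrite leU; apply: bigmeet_lb; exists x. Qed.

Lemma bigmeet_universal_glb (S : set universal) x :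
  (forall y, S y -> x <= y) -> x <= bigmeet_universal S.
Proof. by move=> h; rewrite leU; apply: bigmeet_glb => _ [y /h + <-]; rewrite leU. Qed.

Lemma bigjoin_universal_ub (S : set universal) x : S x -> x <= bigjoin_universal S.
Proof.
move=> Sx; rewrite leU; apply: le_trans (le_starK _).
by apply: bigjoin_ub; exists x.
Qed.

Lemma bigjoin_universal_lub (S : set universal) x :
  (forall y, S y -> y <= x) -> bigjoin_universal S <= x.
Proof.
move=> h; rewrite leU -(eqP (valP x)); apply/le_star/le_star.
by apply: bigjoin_lub => _ [y /h + <-]; rewrite leU.
Qed.

HB.instance Definition _ := POrder_isCompleteLattice.Build (Order.Disp tt tt) universal
  bigmeet_universal_lb bigmeet_universal_glb
  bigjoin_universal_ub bigjoin_universal_lub.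

Lemma star_universalK : involutive star_universal.
Proof. by move=> x; apply: val_inj; rewrite /= (eqP (valP x)). Qed.

Lemma le_star_universal (x y : universal) :
  x <= y -> star_universal y <= star_universal x.
Proof. by rewrite !leU; apply: le_star. Qed.

Lemma meet_star_universal (x : universal) : x `&` star_universal x = \bot.
Proof.
apply/le_anti; rewrite le0x andbT leU; apply/leD_P => A mA.
have := leIl x (star_universal x); rewrite leU => /leD_P/(_ A mA) xA.
have := leIr (star_universal x) x; rewrite leU => /leD_P/(_ A mA).
move=> /mem_star/(_ A xA).
by move=> /orthogonalxx ->; left.
Qed.

Lemma join_star_universal (x : universal) : x `|` star_universal x = \top.
Proof.
have le_invol (u v : universal) : star_universal u <= star_universal v -> v <= u.
  by move=> /le_star_universal; rewrite !star_universalK.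
apply/le_anti; rewrite lex1 /=; apply: le_invol.
apply: le_trans (le0x _); rewrite -(meet_star_universal x) lexI andbC.
rewrite le_star_universal ?leUl//=.
by rewrite -[leRHS]star_universalK le_star_universal// leUr.
Qed.

HB.instance Definition _ := CompleteLattice_isOrtho.Build (Order.Disp tt tt) universal
  star_universalK le_star_universal meet_star_universal join_star_universal.

End Terms.

(* Main.v *)
Require Import Defs.
From mathcomp Require Import all_boot all_order.
From mathcomp Require Import boolp.

(** An element of the universal logic is determined by the families lying
    below it, and these sets of families are exactly the biorthogonally closed
    sets for the relation [orthogonal]; meets are intersections and [star] is
    the orthogonal, so everything reduces to statements about that relation.

    If E is distributive, then a <= b^c as soon as a meets b trivially.  Hence
    two families that are not orthogonal have a nonzero common lower bound,
    their componentwise meet ([nonorthogonal_lower_bound]).  Distributivity of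
    the universal logic follows as in a Boolean algebra: were some A below
    [(x `|` y) `&` z] not below [(x `&` z) `|` (y `&` z)], shrinking A twice
    along non-orthogonal families would give a nonzero family orthogonal to
    itself ([distributive_mem_join]).

    Conversely, E sits inside the universal logic: fix an index n0 and send a
    to the set of families whose n0-th component is at most a.  The largest of
    these is the family equal to a at n0 and to 1 elsewhere, and its orthogonal
    is the image of a^c.  The map [cylinder] thus reflects the order and
    preserves meets and orthocomplements, hence joins, so distributivity
    descends to E. *)

Set Implicit Arguments.
Unset Strict Implicit.
Unset Printing Implicit Defensive.

Import Order.Theory.
Local Open Scope order_scope.

Lemma distributive_lattice_le d (L : latticeType d) :
  (forall x y z : L, (x `|` y) `&` z <= (x `&` z) `|` (y `&` z)) ->
  distributive_lattice L.
Proof.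
move=> distL x y z; apply/le_anti; rewrite distL /= leUx.
by rewrite !leI2 ?leUl ?leUr.
Qed.

Section LogicTheory.
Variables (d : Order.disp_t) (L : logicType d).
Implicit Types x y : L.

Lemma ocompl_join x y : ocompl (x `|` y) = ocompl x `&` ocompl y.
Proof.
apply/le_anti/andP; split.
  by rewrite lexI !le_ocompl ?leUl ?leUr.
rewrite -[leLHS]ocomplK; apply: le_ocompl; rewrite leUx -{1}(ocomplK x).
by rewrite -{2}(ocomplK y) !le_ocompl ?leIl ?leIr.
Qed.

Lemma join_ocompl x y : x `|` y = ocompl (ocompl x `&` ocompl y).
Proof. by rewrite -ocompl_join ocomplK. Qed.

Lemma ocompl_bot : ocompl (\bot : L) = \top.
Proof. by rewrite -(joinx_ocompl (\bot : L)) join0x. Qed.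

Lemma ocompl_top : ocompl (\top : L) = \bot.
Proof. by rewrite -ocompl_bot ocomplK. Qed.

Lemma distributive_disjoint_le_ocompl x y :
  distributive_lattice L -> x `&` y = \bot -> x <= ocompl y.
Proof.
move=> distL xy0; rewrite -[x]meet1x -(joinx_ocompl y) distL.
by rewrite [y `&` x]meetC xy0 join0x leIl.
Qed.

End LogicTheory.

Section UniversalTheory.
Variables (d : Order.disp_t) (E : logicType d) (k : exponent).
Implicit Types (A B C : power E k) (X : dterm E k) (x y z : universal E k).

Lemma mem_dterm0 X : mem_dterm X (pow0 E k).
Proof. by left. Qed.

Lemma mem_dterm_le X A B : le_power A B -> mem_dterm X B -> mem_dterm X A.
Proof.
move=> AB [B0|[i Bi]]; last by right; exists i; apply: le_power_trans AB Bi.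
by left; apply/le_power0; rewrite -B0.
Qed.

Definition star_closed X : universal E k :=
  exist (fun Y => star (star Y) == Y) (star X) (starK_star X).

Lemma universalP x y :
  reflect (forall A, mem_dterm (val x) A -> mem_dterm (val y) A) (x <= y).
Proof. by rewrite leU; apply: leD_P. Qed.

(** Membership is an inequality, from the closed set generated by A, so that
    the universal properties of the lattice operations apply to it. *)
Lemma mem_universal_le A :
  exists u : universal E k, forall x, mem_dterm (val x) A <-> u <= x.
Proof.
pose X : dterm E k := cls (fun _ : unit => A).
exists (star_closed (star X)) => x; split=> [xA|/universalP].
  rewrite leU -[leRHS](eqP (valP x)); apply/le_star/le_star/leD_P => B.
  by move=> /mem_cls[->|[_ BA]]; [apply: mem_dterm0|apply: mem_dterm_le xA].
apply; apply: (leD_P _ _ (le_starK X)); apply/mem_cls; right; exists tt.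
exact: le_power_refl.
Qed.

Lemma mem_meet x y A :
  mem_dterm (val (x `&` y)) A <-> mem_dterm (val x) A /\ mem_dterm (val y) A.
Proof.
have [u uP] := mem_universal_le A; rewrite !uP lexI.
by split=> [/andP|] // [-> ->].
Qed.

Lemma mem_ocompl x A :
  mem_dterm (val (ocompl x)) A <->
  forall B, mem_dterm (val x) B -> orthogonal A B.
Proof. exact: mem_star. Qed.

Lemma mem_join x y A :
  mem_dterm (val (x `|` y)) A <->
  forall B, mem_dterm (val (ocompl x)) B -> mem_dterm (val (ocompl y)) B ->
    orthogonal A B.
Proof.
rewrite join_ocompl mem_ocompl; split=> AP B.
  by move=> xB yB; apply/AP/mem_meet.
by move=> /mem_meet[xB yB]; apply: AP.
Qed.

Lemma nonorthogonal_lower_bound A B :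
  distributive_lattice E -> ~ orthogonal A B ->
  exists C, [/\ C <> pow0 E k, le_power C A & le_power C B].
Proof.
move=> distE nAB; pose c n := component A n `&` component B n.
have nc : ~ vanishes c.
  by move=> [n cn]; apply: nAB; exists n; apply: distributive_disjoint_le_ocompl.
exists (pow c); split=> [/pow_eq0 //|n|n]; rewrite component_pow //.
  exact: leIl.
exact: leIr.
Qed.

(** If C were not orthogonal to some D in x, a nonzero common lower bound of C
    and D would belong to [x `&` z], hence be orthogonal to C and to itself.
    So C is orthogonal to x, likewise to y, and therefore to itself. *)
Lemma distributive_mem_join x y z C :
  distributive_lattice E ->
  mem_dterm (val (x `|` y)) C -> mem_dterm (val z) C ->
  mem_dterm (val (ocompl (x `&` z))) C ->
  mem_dterm (val (ocompl (y `&` z))) C -> C = pow0 E k.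
Proof.
move=> distE xyC zC xzC yzC.
have perp t : mem_dterm (val (ocompl (t `&` z))) C ->
    mem_dterm (val (ocompl t)) C.
  move=> tzC; apply/mem_ocompl => D tD.
  have [//|nCD] := pselect (orthogonal C D).
  have [G [G0 GC GD]] := nonorthogonal_lower_bound distE nCD.
  case: G0; apply: orthogonalxx; apply: (orthogonal_le GC).
  apply: (iffLR (mem_ocompl _ _) tzC).
  by apply/mem_meet; split; [apply: mem_dterm_le tD|apply: mem_dterm_le zC].
by apply: orthogonalxx; apply: (iffLR (mem_join _ _ _) xyC); apply: perp.
Qed.

Lemma distributive_universal :
  distributive_lattice E -> distributive_lattice (universal E k).
Proof.
move=> distE; apply: distributive_lattice_le => x y z.
apply/universalP => A /mem_meet[xyA zA]; apply/mem_join => B xzB yzB.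
have [//|nAB] := pselect (orthogonal A B).
have [C [C0 CA CB]] := nonorthogonal_lower_bound distE nAB.
by case: C0; apply: (@distributive_mem_join x y z); rewrite //;
  [apply: mem_dterm_le xyA|apply: mem_dterm_le zA
  |apply: mem_dterm_le xzB|apply: mem_dterm_le yzB].
Qed.

Section Cylinder.
Variable n0 : k.

Definition cylinder_family (a : E) : power E k :=
  pow (fun n => if `[< n = n0 >] then a else \top).

(** If the family vanishes, all its components become 0; but then a was 0
    already, since either a is the vanishing entry or E is trivial. *)
Lemma component_cylinder_family a : component (cylinder_family a) n0 = a.
Proof.
rewrite /cylinder_family.
set c := (fun n => _); have [vc|nvc] := pselect (vanishes c); last first.
  by rewrite component_pow // /c; case: asboolP.
rewrite component_pow0 //; have [n] := vc; rewrite /c.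
case: asboolP => // _ top0.
by apply/esym/eqP; rewrite -lex0 -top0 lex1.
Qed.

Lemma orthogonal_cylinder_family A a :
  orthogonal A (cylinder_family a) <-> component A n0 <= ocompl a.
Proof.
split=> [[n]|An0]; last by exists n0; rewrite component_cylinder_family.
have [->|nn0] := pselect (n = n0); first by rewrite component_cylinder_family.
have [va|nva] := pselect
    (vanishes (fun n => if `[< n = n0 >] then a else \top)).
  have -> : a = \bot.
    by rewrite -[LHS]component_cylinder_family /cylinder_family component_pow0.
  by rewrite ocompl_bot lex1.
rewrite component_pow //; case: asboolP => // _; rewrite ocompl_top lex0.
move=> /eqP An; have -> : A = pow0 E k by apply/component_vanish; exists n.
by rewrite /component eqxx le0x.
Qed.

(** Written as an orthogonal so that it is closed by construction. *)
Definition cylinder (a : E) : universal E k :=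
  star_closed (cls (fun _ : unit => cylinder_family (ocompl a))).

Lemma mem_cylinder a A : mem_dterm (val (cylinder a)) A <-> component A n0 <= a.
Proof.
rewrite /= star_cls mem_cls below_star -[in X in _ <-> X](ocomplK a).
by rewrite -orthogonal_cylinder_family; split=> // /(_ tt).
Qed.

Lemma le_cylinder a b : (cylinder a <= cylinder b) = (a <= b).
Proof.
apply/universalP/idP => [ab|ab A /mem_cylinder Aa].
  have /ab/mem_cylinder : mem_dterm (val (cylinder a)) (cylinder_family a).
    by apply/mem_cylinder; rewrite component_cylinder_family.
  by rewrite component_cylinder_family.
by apply/mem_cylinder; apply: le_trans Aa ab.
Qed.

Lemma cylinder_inj : injective cylinder.
Proof. by move=> a b ab; apply/le_anti; rewrite -!le_cylinder ab lexx. Qed.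

Lemma universal_ext x y :
  (forall A, mem_dterm (val x) A <-> mem_dterm (val y) A) -> x = y.
Proof. by move=> xy; apply/val_inj/dtermP. Qed.

Lemma cylinder_meet a b : cylinder (a `&` b) = cylinder a `&` cylinder b.
Proof.
apply: universal_ext => A; rewrite mem_meet !mem_cylinder lexI.
by split=> [/andP|] // [-> ->].
Qed.

Lemma cylinder_ocompl a : cylinder (ocompl a) = ocompl (cylinder a).
Proof.
apply: universal_ext => A; rewrite mem_ocompl mem_cylinder.
split=> [Aa B /mem_cylinder Ba|]; last first.
  move/(_ (cylinder_family a)); rewrite orthogonal_cylinder_family; apply.
  by apply/mem_cylinder; rewrite component_cylinder_family.
by exists n0; apply: le_trans Aa _; apply: le_ocompl.
Qed.

Lemma cylinder_join a b : cylinder (a `|` b) = cylinder a `|` cylinder b.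
Proof. by rewrite !join_ocompl cylinder_ocompl cylinder_meet !cylinder_ocompl. Qed.

End Cylinder.

Lemma distributive_of_universal :
  distributive_lattice (universal E k) -> distributive_lattice E.
Proof.
have [n0] := exponent_inhabited k; move=> distU a b c.
apply: (@cylinder_inj n0).
by rewrite cylinder_meet !cylinder_join distU !cylinder_meet.
Qed.

End UniversalTheory.

Theorem theorem24 (d : Order.disp_t) (E : logicType d) :
  (distributive_lattice E ->
     forall k : exponent, distributive_lattice (universal E k)) /\
  ((exists k : exponent, distributive_lattice (universal E k)) ->
     distributive_lattice E).
Proof.
split=> [distE k|[k]]; first exact: distributive_universal.
exact: distributive_of_universal.
Qed.
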